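(* Given an initial conformation $c$ of solitaire Clobber on the line, an optimal word admissible for $c$ (that is, a word admissible for $c$ having the minimum number of barred letters $\overline a,\overline s$ among all words admissible for $c$) can be found in time $\Theta(|c|)$. As a consequence, the reducibility value of $c$ and a sequence of moves attaining this value can be found in linear time (in $|c|$).
   Context: Solitaire Clobber on the line: an initial conformation is a nonempty word $c=c_1\cdots c_n$, $c_i\in\{\bullet,\circ\}$, of length $n=|c|$; a pawn of color $c_i$ (black or white) is placed on position $i$, for $i=1,\dots,n$, and positions $i,i+1$ are adjacent. A legal move consists in moving a pawn from its position onto an adjacent position occupied by a pawn of the opposite color; that latter pawn is removed (taken), and the position left becomes empty (and can never be reoccupied). The single player may move a pawn of either color at each turn. A game on $c$ is any finite (possibly empty) sequence of legal moves starting from $c$. The reducibility value of $c$ is the smallest number of remaining pawns that can be obtained by a game on $c$; a sequence of moves attains it if it leaves exactly that many pawns. Words: in a game each separation between positions $i$ and $i+1$ is crossed by at most one pawn. To a game on $c$ one associates the word $w=w_1\cdots w_{n-1}$ over $\Sigma=\{\overline a,\overline s,\overrightarrow a,\overrightarrow s,\overleftarrow a,\overleftarrow s\}$ as follows: the base letter of $w_i$ is $s$ if $c_i=c_{i+1}$ and $a$ if $c_i\ne c_{i+1}$; it carries $\rightarrow$ if during the game a pawn moves from $i$ to $i+1$, $\leftarrow$ if a pawn moves from $i+1$ to $i$, and a bar if the separation is not crossed. A word is admissible for $c$ if it is associated in this way with some game on $c$ in which no pawn having already moved is taken by a pawn that has not moved yet. Time is counted in elementary operations in the usual sense of algorithm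 analysis. *)

(* Defs.v *)
From mathcomp Require Import all_boot.

Set Implicit Arguments.
Unset Strict Implicit.
Unset Printing Implicit Defensive.

(** * Solitaire Clobber on the line

    Positions are numbered from 0, so the position written
    [i] on paper is [i.-1] here, and the separation between positions [i] and
    [i.+1] carries the letter of index [i] of a word. *)

(** [true] is black, [false] is white. *)
Definition conformation := seq bool.

(** [moved] records whether the pawn has already moved in the current game. *)
Record pawn := Pawn { black : bool; moved : bool }.

Definition board := seq (option pawn).

Definition start (c : conformation) : board :=
  [seq Some (Pawn x false) | x <- c].

(** (position left, position reached) *)
Definition clobber_move := (nat * nat)%type.

Definition legal (b : board) (m : clobber_move) : bool :=
  ((m.2 == m.1.+1) || (m.1 == m.2.+1)) &&
  match nth None b m.1, nth None b m.2 with
  | Some p, Some q => black p != black q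
  | _, _ => false
  end.

Definition apply_move (b : board) (m : clobber_move) : board :=
  match nth None b m.1 with
  | Some p =>
      set_nth None (set_nth None b m.1 None) m.2 (Some (Pawn (black p) true))
  | None => b
  end.

Fixpoint game_from (b : board) (g : seq clobber_move) : bool :=
  if g is m :: g' then legal b m && game_from (apply_move b m) g' else true.

Definition game (c : conformation) (g : seq clobber_move) : bool :=
  game_from (start c) g.

Definition remaining (c : conformation) (g : seq clobber_move) : nat :=
  count isSome (foldl apply_move (start c) g).

Definition is_reducibility_value (c : conformation) (v : nat) : Prop :=
  (exists2 g, game c g & remaining c g = v) /\
  (forall g, game c g -> v <= remaining c g).

Definition moved_not_taken_by_unmoved (b : board) (m : clobber_move) : bool :=
  match nth None b m.1, nth None b m.2 with
  | Some p, Some q => ~~ (moved q && ~~ moved p)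
  | _, _ => true
  end.

Fixpoint restrained_from (b : board) (g : seq clobber_move) : bool :=
  if g is m :: g' then
    moved_not_taken_by_unmoved b m && restrained_from (apply_move b m) g'
  else true.

(** No pawn having already moved is taken by a pawn that has not moved yet. *)
Definition restrained (c : conformation) (g : seq clobber_move) : bool :=
  restrained_from (start c) g.

(** ** Words *)

(** A bar means that the separation is not crossed, [right] and [left] give the
    direction of the crossing; the base is [s] for equal neighbouring colors
    and [a] for different ones. *)
Variant letter := a_bar | s_bar | a_right | s_right | a_left | s_left.

Definition barred (l : letter) : bool :=
  match l with a_bar | s_bar => true | _ => false end.

Definition crossing_letter
    (c : conformation) (g : seq clobber_move) (i : nat) : letter :=
  let same := nth false c i == nth false c i.+1 in
  if (i, i.+1) \in g then (if same then s_right else a_right)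
  else if (i.+1, i) \in g then (if same then s_left else a_left)
  else (if same then s_bar else a_bar).

Definition word_of (c : conformation) (g : seq clobber_move) : seq letter :=
  [seq crossing_letter c g i | i <- iota 0 (size c).-1].

Definition admissible (c : conformation) (w : seq letter) : Prop :=
  exists g, [/\ game c g, restrained c g & w = word_of c g].

Definition optimal (c : conformation) (w : seq letter) : Prop :=
  admissible c w /\
  (forall w', admissible c w' -> count barred w <= count barred w').

(** * Random access machine

    Structured programs over a word RAM: finitely many registers are used by
    any given program, the memory is addressed indirectly through registers,
    and every elementary instruction or test takes one unit of time.  All
    numbers written must be at most a capacity [M]; an instruction whose result
    exceeds [M] has no execution. *)

Variant test := Less (r s : nat) | Equal (r s : nat).

Inductive prog :=
| Skip
| Const (r k : nat)
| Copy (r s : nat)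
| Add (r s u : nat)
| Sub (r s u : nat)
| Read (r s : nat)
| Write (r s : nat)
| Seq (p q : prog)
| If (b : test) (p q : prog)
| While (b : test) (p : prog).

Record state := State { reg : nat -> nat; mem : nat -> nat }.

Definition upd (f : nat -> nat) (x v : nat) : nat -> nat :=
  fun y => if y == x then v else f y.

Definition set_reg (s : state) (r v : nat) : state :=
  State (upd (reg s) r v) (mem s).

Definition set_mem (s : state) (x v : nat) : state :=
  State (reg s) (upd (mem s) x v).

Definition holds (b : test) (s : state) : bool :=
  match b with
  | Less r u => reg s r < reg s u
  | Equal r u => reg s r == reg s u
  end.

(** [exec M p s s' t]: started in [s], the program [p] halts in [s'] after
    exactly [t] units of time. *)
Inductive exec (M : nat) : prog -> state -> state -> nat -> Prop :=
| exec_skip s : exec M Skip s s 1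
| exec_const s r k : k <= M -> exec M (Const r k) s (set_reg s r k) 1
| exec_copy s r u : exec M (Copy r u) s (set_reg s r (reg s u)) 1
| exec_add s r u v : reg s u + reg s v <= M ->
    exec M (Add r u v) s (set_reg s r (reg s u + reg s v)) 1
| exec_sub s r u v :
    exec M (Sub r u v) s (set_reg s r (reg s u - reg s v)) 1
| exec_read s r u : exec M (Read r u) s (set_reg s r (mem s (reg s u))) 1
| exec_write s r u : exec M (Write r u) s (set_mem s (reg s r) (reg s u)) 1
| exec_seq p q s1 s2 s3 t1 t2 :
    exec M p s1 s2 t1 -> exec M q s2 s3 t2 ->
    exec M (Seq p q) s1 s3 (t1 + t2)
| exec_if b p q s s' t :
    exec M (if holds b s then p else q) s s' t ->
    exec M (If b p q) s s' t.+1
| exec_while_stop b p s : ~~ holds b s -> exec M (While b p) s s 1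
| exec_while_step b p s1 s2 s3 t1 t2 :
    holds b s1 -> exec M p s1 s2 t1 -> exec M (While b p) s2 s3 t2 ->
    exec M (While b p) s1 s3 (t1 + t2).+1.

(** Register 0 initially holds the length of the conformation, and memory cell
    [i < size c] holds 1 or 0 according to whether pawn [i] is black or white;
    all other registers and cells hold 0. *)
Definition input (c : conformation) : state :=
  State (upd (fun=> 0) 0 (size c)) (fun i => nat_of_bool (nth false c i)).

(** The result is the memory block whose address and length are found in
    registers 0 and 1 on halting. *)
Definition output (s : state) : seq nat :=
  [seq mem s (reg s 0 + i) | i <- iota 0 (reg s 1)].

(** The capacity [m * size c] amounts to words of [log2 (size c) + O(1)]
    bits. *)
Definition runs (p : prog) (m : nat) (c : conformation) (out : seq nat)
    (t : nat) : Prop :=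
  exists2 s, exec (m * size c) p (input c) s t & output s = out.

Definition letter_code (l : letter) : nat :=
  match l with
  | a_bar => 0 | s_bar => 1
  | a_right => 2 | s_right => 3
  | a_left => 4 | s_left => 5
  end.

Definition word_code (w : seq letter) : seq nat := map letter_code w.

Definition moves_code (g : seq clobber_move) : seq nat :=
  flatten [seq [:: m.1; m.2] | m <- g].

(* Main.v *)
(** A segment of the line can be reduced to one pawn exactly when it is a single
    pawn or has the form x y^k x^j y with y the color opposite to x.  Undoing a
    move turns the segment x s into x y s and keeps this form, so a game never
    leaves fewer pawns than the least number of such segments into which [c]
    splits.  Conversely a splitting is realised by first playing all the left
    moves from right to left, which collects x^j y on the first x of that block,
    and then all the right moves from left to right.  The form is regular, so an
    optimal splitting comes from a dynamic program with four states, run by two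
    passes over [c]: one stores the source of each transition, the other follows
    these sources back and emits the letters, or the moves. The left moves fill the
    output buffer from its beginning and the right moves from its end. *)

From mathcomp Require Import all_boot zify.
Require Import Defs.

(** * Reducible segments and the lower bound *)

Inductive reducible : seq bool -> Prop :=
| reducible1 x : reducible [:: x]
| reducible_runs x k j :
    reducible (x :: nseq k (~~ x) ++ nseq j x ++ [:: ~~ x]).

(** Reading backwards exchanges the two exponents. *)
Lemma reducible_rev s : reducible s -> reducible (rev s).
Proof.
case=> [x|x k j]; first exact: reducible1.
have := reducible_runs (~~ x) j k.
by rewrite negbK rev_cons !rev_cat !rev_nseq -cats1 -!catA.
Qed.

(** The pawn put back lengthens the run y^k by one; a single pawn becomes x y, the form with k = j =
    0. *)
Lemma reducible_unmove x s : reducible (x :: s) -> reducible [:: x, ~~ x & s].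
Proof.
move E: (x :: s) => w r; case: r E => [y|y k j] [-> ->].
  exact: (reducible_runs y 0 0).
exact: (reducible_runs y k.+1 j).
Qed.

Inductive splits : seq (option bool) -> nat -> Prop :=
| splits_nil : splits [::] 0
| splits_empty b k : splits b k -> splits (None :: b) k
| splits_word s b k :
    reducible s -> splits b k -> splits (map Some s ++ b) k.+1.

Lemma splits_cat b1 k1 b2 k2 :
  splits b1 k1 -> splits b2 k2 -> splits (b1 ++ b2) (k1 + k2).
Proof.
move=> h1 h2; elim: h1 => //= [b k _ IH|s b k rs _ IH].
  exact: splits_empty.
by rewrite -catA addSn; apply: splits_word.
Qed.

Lemma splits_rev b k : splits b k -> splits (rev b) k.
Proof.
elim=> [|{}b {}k _ IH|s {}b {}k rs _ IH]; first exact: splits_nil.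
  rewrite rev_cons -cats1 -[k]addn0; apply: splits_cat => //.
  exact/splits_empty/splits_nil.
rewrite rev_cat -map_rev -addn1; apply: splits_cat => //.
rewrite -[map _ _]cats0; apply: splits_word; first exact: reducible_rev.
exact: splits_nil.
Qed.

(** Segments consist of occupied positions, so none straddles [None]. *)
Lemma splits_at_empty u v k : splits (u ++ None :: v) k ->
  exists k1 k2, [/\ splits u k1, splits v k2 & k = k1 + k2].
Proof.
move E: (u ++ _) => w h; elim: h u E => [[]//|b {}k hb IH|s b {}k rs _ IH] u.
  case: u => [|y u] /= [].
    by move=> ->; exists 0, k; split=> //; exact: splits_nil.
  move=> -> /IH [k1 [k2 [h1 h2 ->]]].
  by exists k1, k2; split=> //; exact: splits_empty.
suff H : u ++ None :: v = map Some s ++ b ->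
    exists u', u = map Some s ++ u' /\ u' ++ None :: v = b.
  move=> /H [u' [-> /IH[k1 [k2 [h1 h2 ->]]]]].
  by exists k1.+1, k2; split=> //; exact: splits_word.
elim: s u {rs IH} => [|x s IHs] [|y u] //=; first by move=> <-; exists [::].
  by move=> <-; exists (y :: u).
by case=> -> /IHs [u' [-> <-]]; exists u'.
Qed.

(** The vacated position cuts the splitting, so the moved pawn begins a segment; putting the taken
    pawn back changes that segment only. *)
Lemma splits_unmove_right u x v k :
  splits (u ++ [:: None, Some x & v]) k ->
  splits (u ++ [:: Some x, Some (~~ x) & v]) k.
Proof.
case/splits_at_empty => k1 [k2 [h1 h2 ->]]; apply: splits_cat => //.
move E: (Some x :: v) h2 => w h2; case: h2 E => // s b {}k2 rs hb.
case: s rs => [r|y s rs] /= ; first by inversion r.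
case=> -> ->; apply: (splits_word [:: y, ~~ y & s]) => //.
exact: reducible_unmove.
Qed.

Lemma splits_unmove_left u x v k :
  splits (u ++ [:: Some x, None & v]) k ->
  splits (u ++ [:: Some (~~ x), Some x & v]) k.
Proof.
have E y z : u ++ [:: y, z & v] = rev (rev v ++ [:: z, y & rev u]).
  by rewrite rev_cat !rev_cons !revK -!cats1 -!catA.
by move/splits_rev; rewrite !E revK => /splits_unmove_right/splits_rev.
Qed.

Definition colors (b : board) : seq (option bool) := map (omap black) b.

Lemma splits_count b : splits (colors b) (count isSome b).
Proof.
elim: b => [|[p|] b IH] /=; first exact: splits_nil.
  exact: (splits_word [:: black p]) (reducible1 _) IH.
exact: splits_empty.
Qed.

Lemma legalP b m : legal b m -> exists u p q v,
  [/\ black p != black q,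
      b = u ++ [:: Some p, Some q & v] & m = (size u, (size u).+1)] \/
  [/\ black p != black q,
      b = u ++ [:: Some p, Some q & v] & m = ((size u).+1, size u)].
Proof.
case: m => i j; rewrite /legal /=.
have split2 k p q : nth None b k = Some p -> nth None b k.+1 = Some q ->
    exists u v, b = u ++ [:: Some p, Some q & v] /\ size u = k.
  move=> hp hq.
  have sk : k.+1 < size b.
    by rewrite ltnNge; apply/negP => /(nth_default None); rewrite hq.
  exists (take k b), (drop k.+2 b).
  rewrite -hp -hq -drop_nth // -drop_nth ?cat_take_drop; last exact: ltnW.
  by split=> //; rewrite size_takel //; lia.
case/andP=> /orP [] /eqP -> /=.
  case hp: nth => [p|//]; case hq: nth => [q|//] pq.
  have [u [v [-> su]]] := split2 _ _ _ hp hq.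
  by exists u, p, q, v; left; split=> //; rewrite su.
case hp: nth => [p|//]; case hq: nth => [q|//] pq.
have [u [v [-> su]]] := split2 _ _ _ hq hp.
by exists u, q, p, v; right; split=> //; rewrite ?su // eq_sym.
Qed.

Lemma apply_move_right u p q v :
  apply_move (u ++ [:: Some p, q & v]) (size u, (size u).+1) =
  u ++ [:: None, Some (Pawn (black p) true) & v].
Proof.
rewrite /apply_move /= nth_cat ltnn subnn /=.
by elim: u => //= x u ->.
Qed.

Lemma apply_move_left u p q v :
  apply_move (u ++ [:: q, Some p & v]) ((size u).+1, size u) =
  u ++ [:: Some (Pawn (black p) true), None & v].
Proof.
rewrite /apply_move /= nth_cat ltnNge leqnSn subSnn /=.
by elim: u => //= x u ->.
Qed.

(** The final board splits into single pawns, and undoing the moves one by one keeps the number of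
    segments. *)
Lemma splits_game b g : game_from b g ->
  splits (colors b) (count isSome (foldl apply_move b g)).
Proof.
elim: g b => [b _|m g IH b] /=; first exact: splits_count.
case/andP=> /legalP [u [p [q [v [] [pq -> ->]]]]] /IH.
  rewrite apply_move_right /colors !map_cat /= => /splits_unmove_right.
  by case: p q pq => [[] ?] [[] ?].
rewrite apply_move_left /colors !map_cat /= => /splits_unmove_left.
by case: p q pq => [[] ?] [[] ?].
Qed.

Lemma remaining_game_from b g : game_from b g ->
  count isSome (foldl apply_move b g) + size g = count isSome b.
Proof.
elim: g b => [b _|m g IH b] /=; first exact: addn0.
rewrite addnS => /andP [/legalP [u [p [q [v [] [pq -> ->]]]]]] /IH ->;
  rewrite ?apply_move_right ?apply_move_left !count_cat /=; lia.
Qed.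

Lemma remaining_game c g : game c g -> remaining c g + size g = size c.
Proof.
move/remaining_game_from; rewrite /remaining => ->.
by rewrite /start count_map; elim: c => //= x c ->.
Qed.

(** * Dynamic programming *)

(* Least numbers of segments begun so far, in the states
     ce: a segment has just ended (also the state before the first pawn);
     ca: x has been read, to be continued as x y^k with k >= 1;
     cb: x y^k has been read, k >= 1;
     cd: x y^k x^j has been read, j >= 1 or k = 0.
   The states are coded as 0 for ce, 1 for cb, 2 for cd and 3 for ca. *)
Record costs := Costs { prev : bool; ce : nat; ca : nat; cb : nat; cd : nat }.

(** The last pawn read is y in state cb and x in states ca and cd, so comparing it with the new pawn
    tells whether the new one is x or y. Here [p] closes the current segment, [q] continues it into
    cd, and [a] begins another one. *)
Definition step (s : costs) (x : bool) : costs :=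
  let same := x == prev s in
  let a := (ce s).+1 in
  let p := if same then cb s else cd s in
  let q := if same then cd s else cb s in
  Costs x (if p < a then p else a) a (if same then cb s else ca s)
    (if q < a then q else a).

Definition source (s : costs) (x : bool) (t : nat) : nat :=
  let same := x == prev s in
  let a := (ce s).+1 in
  let p := if same then cb s else cd s in
  let q := if same then cd s else cb s in
  match t with
  | 0 => if p < a then (if same then 1 else 2) else 0
  | 1 => if same then 1 else 3
  | 2 => if q < a then (if same then 2 else 1) else 0
  | _ => 0
  end.

Definition cost_of (s : costs) (t : nat) : nat :=
  match t with 0 => ce s | 1 => cb s | 2 => cd s | _ => ca s end.

(** A segment is begun exactly when state 0 is left, hence the extra unit. *)
Lemma source_cost s x t : 
  cost_of (step s x) t = cost_of s (source s x t) + (source s x t == 0).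
Proof.
case: s => pr e a b d; rewrite /step /source /=.
by case: t => [|[|[|t]]] /=; case: (x == pr) => /=;
  rewrite ?addn0 ?addn1 //; case: (_ < _) => /=; rewrite ?addn0 ?addn1.
Qed.

Lemma source_le s x t : source s x t <= 3.
Proof. by rewrite /source; case: (x == prev s); case: t => [|[|[|t]]] //; case: (_ < _).
Qed.

(** The transitions of the automaton. State 1 is not entered from 0, because y^k needs an x before
    it. *)
Definition follows (same : bool) (s t : nat) : bool :=
  match s with
  | 0 => t != 1
  | 1 => if same then t <= 1 else t == 2
  | 2 => if same then t == 2 else t == 0
  | _ => ~~ same && (t == 1)
  end.

Lemma source_follows s x t : t <= 3 ->
  follows (x == prev s) (source s x t) t.
Proof.
rewrite /source; case: (x == prev s); case: t => [|[|[|[|t]]]] // _;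
  by case: (_ < _).
Qed.

Lemma run_left x j m s : prev s = x -> cd s <= m ->
  ce (foldl step s (nseq j x ++ [:: ~~ x])) <= m.
Proof.
elim: j s => [|j IH] s px dm /=.
  by rewrite px; case: (x) => /=; case: ifP => //; lia.
apply: IH => //=; rewrite px eqxx; case: ifP => //; lia.
Qed.

Lemma run_right x k j m s : prev s = ~~ x -> cb s <= m ->
  ce (foldl step s (nseq k (~~ x) ++ nseq j x ++ [:: ~~ x])) <= m.
Proof.
elim: k s => [|k IH] s px bm /=.
  case: j => [|j] /=; first by rewrite px eqxx; case: ifP => //; lia.
  apply: run_left => //=.
  by rewrite px; case: (x) => /=; case: ifP => //; lia.
by apply: IH => //=; rewrite px eqxx.
Qed.

(** If k = 0, the first pawn leads to cd at once; otherwise it waits in ca and the second pawn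
    reaches cb. *)
Lemma run_reducible s w : reducible w -> ce (foldl step s w) <= (ce s).+1.
Proof.
case=> [x|x k j] /=; first by case: ifP => //; lia.
case: k => [|k] /=; first by apply: run_left => //=; case: ifP => //; lia.
by apply: run_right => //=; case: (x).
Qed.

(** This half gives the lower bound on games; that the value is attained comes from the game built
    below. *)
Lemma run_splits s c k : splits (map Some c) k ->
  ce (foldl step s c) <= ce s + k.
Proof.
move E: (map Some c) => b h; elim: h s c E => [|{}b {}k _ IH|w {}b {}k rw _ IH] s c.
- by case: c => //=; lia.
- by case: c.
move=> E; have := cat_take_drop (size w) c; move: E.
move=> /[dup] /(congr1 (take (size w))) + /(congr1 (drop (size w))).
rewrite -map_take -map_drop take_size_cat ?size_map // drop_size_cat ?size_map //.
have injS : injective (@Some bool) by move=> ? ? [].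
move/(inj_map injS) => -> /IH h <-; rewrite foldl_cat.
have := h (foldl step s w); have := run_reducible s w rw; lia.
Qed.

Lemma run_size s c : ce (foldl step s c) <= ce s + size c.
Proof.
apply: run_splits; elim: c => [|x c IH] /=; first exact: splits_nil.
exact: (splits_word [:: x]) (reducible1 _) IH.
Qed.

(** [inf] exceeds the cost [size c] of taking every pawn alone, which rules out starting in states
    1, 2 and 3. The color [false] is a placeholder for the missing predecessor. *)
Definition costs_at (c : conformation) (i : nat) : costs :=
  let inf := (size c).+1 in
  foldl step (Costs false 0 inf inf inf) (take i c).

Lemma costs_atS c i : i < size c ->
  costs_at c i.+1 = step (costs_at c i) (nth false c i).
Proof. by move=> h; rewrite /costs_at (take_nth false h) foldl_rcons. Qed.

Lemma prev_costs_at c i : i < size c ->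
  prev (costs_at c i.+1) = nth false c i.
Proof. by move=> h; rewrite costs_atS. Qed.

Lemma costs_at_le c i : ce (costs_at c i) <= i.
Proof.
have := run_size (Costs false 0 (size c).+1 (size c).+1 (size c).+1) (take i c).
by rewrite /= size_take_min /costs_at; lia.
Qed.

Definition optimum (c : conformation) : nat := ce (costs_at c (size c)).

Lemma optimum_le_remaining c g : game c g -> optimum c <= remaining c g.
Proof.
move/splits_game; rewrite /colors /start -map_comp /= => h.
rewrite /optimum /costs_at take_size -[remaining c g]add0n.
exact: (run_splits (Costs _ 0 _ _ _)).
Qed.

Fixpoint backtrack (c : conformation) (k : nat) : nat :=
  if k is k'.+1 then
    let i := size c - k in
    source (costs_at c i) (nth false c i) (backtrack c k')
  else 0.

(* State reached after [i] pawns: 0 at both ends, and the separation between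
   the pawns [i.-1] and [i] is crossed unless [tau c i] is 0. *)
Definition tau (c : conformation) (i : nat) : nat := backtrack c (size c - i).

Lemma tau_size c : tau c (size c) = 0.
Proof. by rewrite /tau subnn. Qed.

Lemma tau_source c i : i < size c ->
  tau c i = source (costs_at c i) (nth false c i) (tau c i.+1).
Proof.
move=> h; rewrite /tau.
have -> : size c - i = (size c - i.+1).+1 by lia.
by rewrite /=; congr source; [congr costs_at|congr nth]; lia.
Qed.

Lemma tau_le c i : tau c i <= 3.
Proof. by rewrite /tau; case: subn => //= k; exact: source_le. Qed.

(** [source_cost] telescopes along the run, by induction on the distance to the end of [c]. *)
Lemma optimum_suffix c i : i <= size c ->
  optimum c = cost_of (costs_at c i) (tau c i) +
    count (fun j => tau c j == 0) (iota i (size c - i)).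
Proof.
move=> h; move: (leq_subr i (size c)); rewrite -{2 3 4}(subKn h).
elim: (size c - i) => [_|k IH hk].
  by rewrite subn0 tau_size addn0.
rewrite IH 1?ltnW //.
have -> : size c - k = (size c - k.+1).+1 by lia.
have hi : size c - k.+1 < size c by lia.
by rewrite [iota _ k.+1]/= costs_atS // source_cost -tau_source //= addnA.
Qed.

(** A run started in another state would cost at least [(size c).+1], against the bound [size c] on
    the optimum. *)
Lemma tau0 c : tau c 0 = 0.
Proof.
have h := optimum_suffix c 0 isT; have := costs_at_le c (size c).
move: h; rewrite -/(optimum c) [costs_at c 0]/costs_at take0 /=.
by case: (tau c 0) => [|[|[|t]]] //= ->; lia.
Qed.

Lemma optimum_count c : 
  optimum c = count (fun j => tau c j == 0) (iota 0 (size c)).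
Proof. by rewrite (optimum_suffix c 0) // tau0 subn0 /costs_at take0. Qed.

Lemma tau_follows c i : i.+1 < size c ->
  follows (nth false c i.+1 == nth false c i) (tau c i.+1) (tau c i.+2).
Proof.
move=> h; rewrite -(prev_costs_at c i); last exact: ltnW.
by rewrite (tau_source c i.+1) //; apply/source_follows/tau_le.
Qed.

(** The placeholder color is harmless here: out of state 0, [follows] ignores the colors. *)
Lemma tau1_neq1 c : 0 < size c -> tau c 1 != 1.
Proof.
move=> h; have := source_follows (costs_at c 0) (nth false c 0) (tau c 1) (tau_le _ _).
by rewrite -tau_source // tau0.
Qed.

(** * The game read off an optimal run *)

(** Before the separation the segment reads x (state 3) or x y^k (state 1), and its first pawn
    crosses to the right; in state 2 the closing y crosses to the left. *)
Definition goes_right (t : nat) : bool := (t == 1) || (t == 3).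

Definition lefts (c : conformation) (i : nat) : seq clobber_move :=
  [seq (j, j.-1) | j <- rev (iota i (size c - i)) & tau c j == 2].

Definition rights (c : conformation) (i : nat) : seq clobber_move :=
  [seq (j.-1, j) | j <- iota i (size c - i) & goes_right (tau c j)].

Definition solution (c : conformation) : seq clobber_move :=
  lefts c 0 ++ rights c 0.

Lemma leftsS c i : i < size c ->
  lefts c i = lefts c i.+1 ++ (if tau c i == 2 then [:: (i, i.-1)] else [::]).
Proof.
move=> h; rewrite /lefts; have -> : size c - i = (size c - i.+1).+1 by lia.
by rewrite /= rev_cons filter_rcons; case: ifP; rewrite ?map_rcons ?cats1 ?cats0.
Qed.

Lemma rightsS c i : i < size c ->
  rights c i =
    (if goes_right (tau c i) then [:: (i.-1, i)] else [::]) ++ rights c i.+1.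
Proof.
move=> h; rewrite /rights; have -> : size c - i = (size c - i.+1).+1 by lia.
by rewrite /=; case: ifP.
Qed.

Lemma game_from_cat b g1 g2 : game_from b (g1 ++ g2) =
  game_from b g1 && game_from (foldl apply_move b g1) g2.
Proof. by elim: g1 b => //= m g1 IH b; rewrite IH andbA. Qed.

Lemma restrained_from_cat b g1 g2 : restrained_from b (g1 ++ g2) =
  restrained_from b g1 && restrained_from (foldl apply_move b g1) g2.
Proof. by elim: g1 b => //= m g1 IH b; rewrite IH andbA. Qed.

Lemma apply_move_mkseq f n i j p : i < n -> j < n -> f i = Some p ->
  apply_move (mkseq f n) (i, j) =
  mkseq (fun x => if x == j then Some (Pawn (black p) true)
                  else if x == i then None else f x) n.
Proof.
move=> hi hj fi; rewrite /apply_move /= nth_mkseq // fi.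
have s1 : size (set_nth None (mkseq f n) i None) = n.
  by rewrite size_set_nth size_mkseq; apply/maxn_idPr.
apply: (@eq_from_nth _ None).
  by rewrite size_set_nth s1 size_mkseq; apply/maxn_idPr.
rewrite size_set_nth s1 (maxn_idPr _) // => x hx.
by rewrite !nth_set_nth /= nth_set_nth /= !nth_mkseq.
Qed.

Lemma eq_mkseq_in (T : Type) (f g : nat -> T) n :
  (forall i, i < n -> f i = g i) -> mkseq f n = mkseq g n.
Proof.
move=> h; apply/eq_in_map => i; rewrite mem_iota; exact: h.
Qed.

Lemma ltnS_andb (P : pred nat) j k : P k = false ->
  (j < k.+1) && P j = (j < k) && P j.
Proof.
move=> Pk; have [->|jk] := eqVneq j k; first by rewrite Pk !andbF.
by rewrite ltnS [j <= k]leq_eqVlt (negPf jk).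
Qed.

Section Solution.
Variable c : conformation.
Let n := size c.

(* Content of position [i] once the left moves from the positions [k] and above
   have been played. *)
Definition after_lefts k i : option pawn :=
  if (k <= i) && (tau c i == 2) then None
  else if (k <= i.+1) && (tau c i.+1 == 2)
    then Some (Pawn (~~ nth false c i) true)
  else Some (Pawn (nth false c i) false).

(** All left moves have been played, and the right moves that reach positions below [k]. A pawn
    arriving from the left is the x of its segment: pawn [i.-1] is that x in state 3 and a y in
    state 1, hence the negation. *)
Definition after_rights k i : option pawn :=
  if (i.+1 < k) && goes_right (tau c i.+1) then None
  else if tau c i == 2 then None
  else if (i < k) && goes_right (tau c i)
    then Some (Pawn (nth false c i.-1 (+) (tau c i == 1)) true)
  else Some (Pawn (nth false c i (+) (tau c i.+1 == 2)) (tau c i.+1 == 2)).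

Let legal_play b g b' :=
  [/\ game_from b g, restrained_from b g & foldl apply_move b g = b'].

Lemma lefts_play k : k <= n ->
  legal_play (start c) (lefts c k) (mkseq (after_lefts k) n).
Proof.
move=> hk; rewrite -(subKn hk).
elim: (n - k) (leq_subr k n) => [_|m IH hm] {k hk}.
  rewrite subn0 /lefts subnn /=; split=> //=.
  apply: (@eq_from_nth _ None); rewrite /start ?size_mkseq size_map // => i hi.
  rewrite nth_mkseq // (nth_map false) // /after_lefts leqNgt hi /=.
  case: (ltngtP i.+1 n) => //= [|E]; first by rewrite ltnNge hi.
  by rewrite E tau_size.
have {IH} := IH (ltnW hm).
have -> : n - m = (n - m.+1).+1 by lia.
have : n - m.+1 < n by lia.
move: (n - m.+1) => k hk [g1 g2 g3].
rewrite leftsS //; case: eqP => tk; last first.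
  move/eqP: tk => tk'.
  rewrite cats0; split=> //; rewrite g3; apply: eq_mkseq_in => i hi.
  rewrite /after_lefts.
  have -> : (k.+1 <= i) && (tau c i == 2) = (k <= i) && (tau c i == 2).
    by case: (ltngtP k i) => // <-; rewrite (negPf tk').
  have -> // : (k.+1 <= i.+1) && (tau c i.+1 == 2) =
               (k <= i.+1) && (tau c i.+1 == 2).
  have [<-|ki] := eqVneq k i.+1; first by rewrite (negPf tk') !andbF.
  by rewrite ltn_neqAle ki.
case: k hk tk g1 g2 g3 => [|k] hk tk g1 g2 g3; first by rewrite tau0 in tk.
(* After state 2 comes either another x, again in state 2, or the closing y. In both cases position
   [k.+1] now holds a y, brought by a left move or still in place. *)
have fk := tau_follows c k hk; rewrite tk /= in fk.
pose p := Pawn (~~ nth false c k) (tau c k.+2 == 2).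
have Ek1 : after_lefts k.+2 k.+1 = Some p.
  rewrite /after_lefts ltnn leqnn /= /p.
  by move: fk; case: (nth false c k.+1); case: (nth false c k) => /= /eqP ->.
have Ek : after_lefts k.+2 k = Some (Pawn (nth false c k) false).
  by rewrite /after_lefts !ltnNge !leqnSn /= -ltnNge ltnn.
have hk' : k < n by apply: ltnW.
split.
- rewrite game_from_cat g1 g3 /= andbT /legal /= eqxx orbT /=.
  by rewrite !nth_mkseq // Ek1 Ek /=; case: nth.
- rewrite restrained_from_cat g2 g3 /= andbT /moved_not_taken_by_unmoved /=.
  by rewrite !nth_mkseq // Ek1 Ek.
rewrite foldl_cat g3 /= (apply_move_mkseq _ _ _ _ p) //.
apply: eq_mkseq_in => i hi /=; case: eqP => [->|/eqP ik].
  by rewrite /after_lefts ltnn /= leqnn tk.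
case: eqP => [->|/eqP ik1]; first by rewrite /after_lefts leqnn tk.
rewrite /after_lefts.
have -> : (k.+1 < i) = (k < i) by rewrite [RHS]leq_eqVlt eq_sym (negPf ik1).
by have -> : (k.+1 < i.+1) = (k < i.+1) by lia.
Qed.

Lemma rights_play k : k <= n ->
  legal_play (mkseq (after_lefts 0) n)
    [seq (j.-1, j) | j <- iota 0 k & goes_right (tau c j)]
    (mkseq (after_rights k) n).
Proof.
elim: k => [_|k IH hk].
  split=> //=; apply: eq_mkseq_in => i _.
  rewrite /after_lefts /after_rights /=; case: (tau c i == 2) => //.
  by case: (tau c i.+1 == 2); rewrite ?addbT ?addbF.
have [g1 g2 g3] := IH (ltnW hk).
rewrite -addn1 iotaD filter_cat map_cat add0n addn1.
rewrite [X in _ ++ X]/=; case: ifP => tk; last first.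
  rewrite /= cats0; split=> //; rewrite g3; apply: eq_mkseq_in => i hi.
  rewrite /after_rights.
  by rewrite !(ltnS_andb (fun j => goes_right (tau c j))).
case: k hk tk g1 g2 g3 {IH} => [|k] hk tk g1 g2 g3; first by rewrite tau0 in tk.
have hk' : k < n by apply: ltnW.
have tk2 : (tau c k.+1 == 2) = false by case/orP: tk => /eqP ->.
have f1 := tau_follows c k.
pose x := nth false c k (+) (tau c k.+1 == 1).
pose q := Pawn (nth false c k.+1 (+) (tau c k.+2 == 2)) (tau c k.+2 == 2).
have Eq : after_rights k.+1 k.+1 = Some q.
  by rewrite /after_rights ltnNge leqnSn ltnn /= tk2.
(* State 1 is entered from 1 or 3 only, so a pawn crossing in state 1 has already crossed the
   previous separation. *)
have [mv Ep Hmv] : exists2 mv, after_rights k.+1 k = Some (Pawn x mv) &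
    (tau c k.+1 == 1) -> mv.
  rewrite /after_rights ltnn /= ltnS leqnn /= tk2 /x.
  case: k hk tk hk' tk2 {f1 x q Eq g1 g2 g3} => [|k] hk tk hk' tk2.
    exists false; rewrite ?tau0 /= (negPf (tau1_neq1 c (ltnW hk))) ?addbF //.
  have f0 := tau_follows c k hk'; rewrite /goes_right in tk *.
  move: f0 tk tk2; have := tau_le c k.+1.
  case: (tau c k.+1) => [|[|[|[|?]]]] //= _.
  - by move=> /negPf -> _ _; exists false; rewrite ?addbF.
  - case: eqP => [->|_ /eqP -> //]; move=> h1 /orP [/eqP ->|/eqP E] _.
      by exists true.
    by rewrite E in h1.
  - by case: ifP => _ /eqP ->.
  by case/andP => /= ne /eqP -> _ _; exists true => //; move: ne; do 2!case: nth.
have xq : x != black q.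
  rewrite /x /q /=; move: (f1 hk) tk; case: (tau c k.+1) => [|[|[|[|]]]] //=.
    case: eqP => [->|]; first by case: (tau c k.+2) => [|[|]] //=; case: nth.
    by move=> ne /eqP -> _ /=; move: ne; do 2!case: nth => //.
  by case/andP => ne /eqP -> _ /=; move: ne; do 2!case: nth.
split.
- rewrite game_from_cat g1 g3 /= andbT /legal /= eqxx /=.
  by rewrite !nth_mkseq // Ep Eq.
- rewrite restrained_from_cat g2 g3 /= andbT /moved_not_taken_by_unmoved /=.
  (* The taken pawn has moved only if [tau c k.+2] is 2. This excludes state 3 before it, and in
     state 1 the taking pawn has moved too. *)
  rewrite !nth_mkseq // Ep Eq /=; move: (f1 hk) tk Hmv.
  case: (tau c k.+1) => [|[|[|[|]]]] //=; first by move=> _ _ ->; rewrite ?andbF.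
  by case/andP => _ /eqP ->.
rewrite foldl_cat g3 /= (apply_move_mkseq _ _ _ _ (Pawn x mv)) //=.
apply: eq_mkseq_in => i hi /=; case: eqP => [->|/eqP ik].
  by rewrite /after_rights ltnn /= tk2 ltnS leqnn tk.
case: eqP => [->|/eqP ik1]; first by rewrite /after_rights ltnS leqnn tk.
rewrite /after_rights.
have -> : (i < k.+2) = (i < k.+1) by rewrite ltnS leq_eqVlt (negPf ik).
by have -> : (i.+1 < k.+2) = (i.+1 < k.+1) by lia.
Qed.

Lemma solution_game : game c (solution c) /\ restrained c (solution c).
Proof.
have [l1 l2 l3] := lefts_play 0 isT.
have [r1 r2 _] := rights_play n (leqnn n).
rewrite /game /restrained /solution game_from_cat restrained_from_cat.
by rewrite l1 l2 l3 /rights subn0 r1 r2.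
Qed.

End Solution.

(** * Counting the moves, and optimality of the word of the solution *)

Lemma mem_lefts c i j :
  ((i, j) \in lefts c 0) = [&& i < size c, tau c i == 2 & j == i.-1].
Proof.
apply/mapP/and3P => [[k + [-> ->]]|[h1 h2 /eqP ->]].
  by rewrite mem_filter mem_rev mem_iota subn0 /= => /andP[-> ->].
by exists i => //; rewrite mem_filter mem_rev mem_iota subn0 h1 h2.
Qed.

Lemma mem_rights c i j :
  ((i, j) \in rights c 0) = [&& j < size c, goes_right (tau c j) & i == j.-1].
Proof.
apply/mapP/and3P => [[k + [-> ->]]|[h1 h2 /eqP ->]].
  by rewrite mem_filter mem_iota subn0 /= => /andP[-> ->].
by exists j => //; rewrite mem_filter mem_iota subn0 h1 h2.
Qed.

(** Each index with a nonzero state contributes exactly one move, to the left or to the right. *)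
Lemma size_solution c : optimum c + size (solution c) = size c.
Proof.
rewrite size_cat !size_map !size_filter /lefts count_rev subn0 optimum_count.
rewrite -[RHS](size_iota 0); elim: (iota _ _) => //= i s IH.
have := tau_le c i.
rewrite [goes_right (tau c i)]/goes_right.
case: (tau c i) => [|[|[|[|?]]]] //= _; lia.
Qed.

Lemma remaining_solution c : remaining c (solution c) = optimum c.
Proof.
have := remaining_game c _ (proj1 (solution_game c)).
have := size_solution c; lia.
Qed.

Lemma optimum_is_reducibility_value c : is_reducibility_value c (optimum c).
Proof.
split; last exact: optimum_le_remaining.
exists (solution c); [exact: (proj1 (solution_game c))|exact: remaining_solution].
Qed.

(** [letter_code] is arranged so that base s adds 1 to this value; the program obtains letters by
    addition. *)
Definition crossing_code (t : nat) : nat :=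
  match t with 0 => 0 | 2 => 4 | _ => 2 end.

Lemma crossing_letter_solution c i : i < (size c).-1 ->
  letter_code (crossing_letter c (solution c) i) =
    (nth false c i == nth false c i.+1) + crossing_code (tau c i.+1).
Proof.
move=> hi; rewrite /crossing_letter !mem_cat !mem_lefts !mem_rights /=.
have -> : i < size c by lia.
have -> : i.+1 < size c by lia.
rewrite eqxx.
have -> : (i.+1 == i.-1) = false by lia.
rewrite !andbF /= !andbT ?orbF /goes_right.
have := tau_le c i.+1.
by case: (tau c i.+1) => [|[|[|[|?]]]] //= _; case: (_ == _).
Qed.

Lemma size_word_of c g : size (word_of c g) = (size c).-1.
Proof. by rewrite size_map size_iota. Qed.

Lemma barred_code l : barred l = (letter_code l < 2).
Proof. by case: l. Qed.

(** The zeros of [tau] are the barred separations and index 0, where the first segment begins; the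
    successor accounts for the latter. *)
Lemma barred_solution c : c <> [::] ->
  (count barred (word_of c (solution c))).+1 = optimum c.
Proof.
case: c => // x c _; set d := x :: c.
rewrite optimum_count /= tau0 /= add1n; congr _.+1.
rewrite count_map (iotaDl 1 0) count_map; apply: eq_in_count => i.
rewrite mem_iota => hi /=; rewrite barred_code crossing_letter_solution //.
have := tau_le d i.+1; rewrite add1n.
by case: (tau d i.+1) => [|[|[|[|?]]]] //= _; case: (_ == _).
Qed.

(** Different crossed separations need different moves: a move is sent to the smaller of its two
    positions. *)
Lemma crossed_le_size c g : (size c).-1 <= count barred (word_of c g) + size g.
Proof.
rewrite -(size_word_of c g) -(count_predC barred) leq_add2l.
rewrite count_map -size_filter.
rewrite -(size_map (fun m : clobber_move => minn m.1 m.2) g).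
apply: uniq_leq_size; first exact/filter_uniq/iota_uniq.
move=> i; rewrite mem_filter /= /crossing_letter => /andP [+ _].
case: ifP => [h _|_]; first by apply/mapP; exists (i, i.+1) => //=; lia.
case: ifP => [h _|_]; first by apply/mapP; exists (i.+1, i) => //=; lia.
by case: ifP.
Qed.

Lemma solution_optimal c : c <> [::] -> optimal c (word_of c (solution c)).
Proof.
move=> h; have [g1 g2] := solution_game c; split.
  by exists (solution c).
move=> w [g [gg _ ->]].
(* Each move removes one pawn, so the word of [g] has at least [remaining c g - 1] barred
   letters. *)
have := crossed_le_size c g; have := remaining_game _ _ gg.
have := optimum_le_remaining _ _ gg; have := barred_solution c h; lia.
Qed.

(** * Verified programs *)

(* [wp] of a loop is [False], as only loop-free programs are treated this way. *)
Fixpoint wp (M : nat) (p : prog) (Q : state -> Prop) (s : state) : Prop :=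
  match p with
  | Skip => Q s
  | Const r k => k <= M /\ Q (set_reg s r k)
  | Copy r u => Q (set_reg s r (reg s u))
  | Add r u v => reg s u + reg s v <= M /\ Q (set_reg s r (reg s u + reg s v))
  | Sub r u v => Q (set_reg s r (reg s u - reg s v))
  | Read r u => Q (set_reg s r (mem s (reg s u)))
  | Write r u => Q (set_mem s (reg s r) (reg s u))
  | Seq p q => wp M p (wp M q Q) s
  | If b p q => if holds b s then wp M p Q s else wp M q Q s
  | While _ _ => False
  end.

Lemma wp_mono M p (Q Q' : state -> Prop) s : (forall s', Q s' -> Q' s') ->
  wp M p Q s -> wp M p Q' s.
Proof.
elim: p Q Q' s => [|r k|r u|r u v|r u v|r u|r u|p IHp q IHq|b p IHp q IHq|//];
  move=> Q Q' s h /=; try exact: h; try by case=> ? /h.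
  by apply: IHp => s'; exact: IHq.
by case: holds; [exact: IHp|exact: IHq].
Qed.

Fixpoint max_time (p : prog) : nat :=
  match p with
  | Seq p q => max_time p + max_time q
  | If _ p q => (maxn (max_time p) (max_time q)).+1
  | _ => 1
  end.

Definition halts M p s (Q : state -> Prop) lo hi :=
  exists s' t, [/\ exec M p s s' t, Q s' & lo <= t <= hi].

Lemma wp_halts M p Q s : wp M p Q s -> halts M p s Q 0 (max_time p).
Proof.
elim: p Q s => [|r k|r u|r u v|r u v|r u|r u|p IHp q IHq|b p IHp q IHq|//] Q s /=.
- by move=> h; exists s, 1; split=> //; constructor.
- by case=> hk h; eexists _, 1; split; [constructor|exact: h|].
- by move=> h; eexists _, 1; split; [constructor|exact: h|].
- by case=> hk h; eexists _, 1; split; [constructor|exact: h|].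
- by move=> h; eexists _, 1; split; [constructor|exact: h|].
- by move=> h; eexists _, 1; split; [constructor|exact: h|].
- by move=> h; eexists _, 1; split; [constructor|exact: h|].
- move=> /IHp [s1 [t1 [e1 /IHq [s2 [t2 [e2 h b2]]] b1]]].
  exists s2, (t1 + t2); split=> //; first exact: exec_seq e1 e2.
  lia.
- case E: (holds b s) => h; [have := IHp _ _ h|have := IHq _ _ h];
    move=> [s' [t [e h' bt]]];
    exists s', t.+1; (split; [by constructor; rewrite E|by []|lia]).
Qed.

Lemma halts_seq M p q s (Q1 Q2 : state -> Prop) lo1 lo2 hi1 hi2 :
  halts M p s Q1 lo1 hi1 -> (forall s', Q1 s' -> halts M q s' Q2 lo2 hi2) ->
  halts M (Seq p q) s Q2 (lo1 + lo2) (hi1 + hi2).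
Proof.
move=> [s1 [t1 [e1 /[swap] b1 h]]] /(_ s1 h) [s2 [t2 [e2 h2 b2]]].
exists s2, (t1 + t2); split=> //; first exact: exec_seq e1 e2.
lia.
Qed.

(** [k] is the number of iterations left, so [I] is invariant and variant at once. An iteration
    lasts at least one unit, whence the lower bound [k]. *)
Lemma while_halts M b p (I : nat -> state -> Prop) k s :
  (forall k s, I k.+1 s -> holds b s /\ wp M p (I k) s) ->
  (forall s, I 0 s -> ~~ holds b s) ->
  I k s -> halts M (While b p) s (I 0) k (k * (max_time p).+1).+1.
Proof.
move=> hS h0; elim: k s => [|k IH] s.
  by move=> h; exists s, 1; split=> //; constructor; exact: h0.
move=> /hS [hb /wp_halts [s1 [t1 [e1 /IH [s2 [t2 [e2 h2 b2]]] b1]]]].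
exists s2, (t1 + t2).+1; split=> //; first exact: exec_while_step e1 e2.
rewrite mulSn; lia.
Qed.

Definition seqs (l : seq prog) : prog := foldr Seq Skip l.

(* Registers: 0 size, 1 index, 2 previous color, 3-6 costs ce, ca, cb, cd,
   8 table pointer, 9, 10, 11, 18 the constants 1, 2, 3, 4, 12 the constant 0.
   The source of target [t] at index [i] is stored in cell [n + 4 * i + t]. *)
Definition setup : prog :=
  seqs [:: Const 9 1; Const 10 2; Const 11 3; Const 18 4;
           Add 4 0 9; Copy 5 4; Copy 6 4; Copy 8 0].

(** Registers 13 and 14 hold [p] and [q] of [step]; 15, 16 and 17 hold the sources of targets 0, 2
    and 1. Cell [i] exchanges its color, kept in register 2, for the comparison with the preceding
    color. *)
Definition table_body : prog :=
  seqs [:: Read 7 1;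
    If (Equal 7 2)
      (seqs [:: Write 1 9; Copy 13 5; Copy 14 6;
                Copy 15 9; Copy 16 10; Copy 17 9])
      (seqs [:: Write 1 12; Copy 13 6; Copy 14 5;
                Copy 15 10; Copy 16 9; Copy 17 11; Copy 5 4]);
    Copy 2 7; Add 4 3 9;
    If (Less 13 4) (Copy 3 13) (seqs [:: Copy 3 4; Copy 15 12]);
    If (Less 14 4) (Copy 6 14) (seqs [:: Copy 6 4; Copy 16 12]);
    Write 8 15; Add 8 8 9; Write 8 17; Add 8 8 9; Write 8 16; Add 8 8 10;
    Add 1 1 9].

Definition table : prog := Seq setup (While (Less 1 0) table_body).

Definition same_at (c : conformation) (i : nat) : bool :=
  nth false c i == prev (costs_at c i).

Record constants (c : conformation) (s : state) : Prop := Constants {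
  const_n : reg s 0 = size c;
  const_1 : reg s 9 = 1;
  const_2 : reg s 10 = 2;
  const_3 : reg s 11 = 3;
  const_0 : reg s 12 = 0;
  const_4 : reg s 18 = 4 }.

Record table_upto (c : conformation) (i : nat) (s : state) : Prop := TableUpto {
  upto_same : forall j, j < i -> mem s j = same_at c j;
  upto_source : forall j k, j < i -> k <= 3 ->
    mem s (size c + 4 * j + k) = source (costs_at c j) (nth false c j) k }.

(** Target 3 always has source 0, so its cells are never written, and [inv_zero] keeps them correct.
    Register 19 already holds the final state of the run. *)
Record table_inv (c : conformation) (i : nat) (s : state) : Prop := TableInv {
  inv_const : constants c s;
  inv_i : reg s 1 = i;
  inv_prev : reg s 2 = prev (costs_at c i);
  inv_e : reg s 3 = ce (costs_at c i);
  inv_a : reg s 4 = ca (costs_at c i);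
  inv_b : reg s 5 = cb (costs_at c i);
  inv_d : reg s 6 = cd (costs_at c i);
  inv_ptr : reg s 8 = size c + 4 * i;
  inv_target : reg s 19 = 0;
  inv_upto : table_upto c i s;
  inv_input : forall j, i <= j < size c -> mem s j = nth false c j;
  inv_zero : forall j, mem s (size c + 4 * j + 3) = 0 }.

Lemma nat_of_bool_eq (x y : bool) : (x == y :> nat) = (x == y).
Proof. by case: x; case: y. Qed.

(** * Symbolic execution of loop-free programs *)

Section WpRules.
Variables (M : nat) (p : prog) (Q : state -> Prop) (s : state).

Lemma wp_skip_last : Q s -> wp M Skip Q s.
Proof. by []. Qed.

Lemma wp_skip : wp M p Q s -> wp M (Seq Skip p) Q s.
Proof. by []. Qed.

Lemma wp_assoc p1 p2 :
  wp M (Seq p1 (Seq p2 p)) Q s -> wp M (Seq (Seq p1 p2) p) Q s.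
Proof. by []. Qed.

Lemma wp_const r k : k <= M -> wp M p Q (set_reg s r k) ->
  wp M (Seq (Const r k) p) Q s.
Proof. by []. Qed.

Lemma wp_copy r u v : reg s u = v -> wp M p Q (set_reg s r v) ->
  wp M (Seq (Copy r u) p) Q s.
Proof. by move=> <-. Qed.

Lemma wp_add r u u' v v' : reg s u = v -> reg s u' = v' -> v + v' <= M ->
  wp M p Q (set_reg s r (v + v')) -> wp M (Seq (Add r u u') p) Q s.
Proof. by move=> <- <-. Qed.

Lemma wp_sub r u u' v v' : reg s u = v -> reg s u' = v' ->
  wp M p Q (set_reg s r (v - v')) -> wp M (Seq (Sub r u u') p) Q s.
Proof. by move=> <- <-. Qed.

Lemma wp_read r u a v : reg s u = a -> mem s a = v ->
  wp M p Q (set_reg s r v) -> wp M (Seq (Read r u) p) Q s.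
Proof. by move=> <- <-. Qed.

Lemma wp_write r u a v : reg s r = a -> reg s u = v ->
  wp M p Q (set_mem s a v) -> wp M (Seq (Write r u) p) Q s.
Proof. by move=> <- <-. Qed.

Lemma wp_less r u v v' q1 q2 : reg s r = v -> reg s u = v' ->
  (v < v' = true -> wp M (Seq q1 p) Q s) ->
  (v < v' = false -> wp M (Seq q2 p) Q s) ->
  wp M (Seq (If (Less r u) q1 q2) p) Q s.
Proof. by move=> /= -> ->; case: (v < v') => h1 h2; [exact: h1|exact: h2]. Qed.

Lemma wp_equal r u v v' q1 q2 : reg s r = v -> reg s u = v' ->
  ((v == v') = true -> wp M (Seq q1 p) Q s) ->
  ((v == v') = false -> wp M (Seq q2 p) Q s) ->
  wp M (Seq (If (Equal r u) q1 q2) p) Q s.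
Proof. by move=> /= -> ->; case: (v == v') => h1 h2; [exact: h1|exact: h2]. Qed.

Lemma reg_set r v : reg (set_reg s r v) r = v.
Proof. by rewrite /= /upd eqxx. Qed.

Lemma reg_set_other r v r' w : (r' == r) = false -> reg s r' = w ->
  reg (set_reg s r v) r' = w.
Proof. by rewrite /= /upd => -> . Qed.

Lemma reg_set_mem a v r w : reg s r = w -> reg (set_mem s a v) r = w.
Proof. by []. Qed.

End WpRules.

Ltac look :=
  first [ apply reg_set
        | apply reg_set_other; [reflexivity | look]
        | apply reg_set_mem; look
        | eassumption ].

Ltac wp_step :=
  lazymatch goal with
  | |- wp _ (seqs _) _ _ => unfold seqs, foldr
  | |- wp _ (Seq (seqs _) _) _ _ => unfold seqs, foldr
  | |- wp _ Skip _ _ => apply wp_skip_last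
  | |- wp _ (Seq Skip _) _ _ => apply wp_skip
  | |- wp _ (Seq (Seq _ _) _) _ _ => apply wp_assoc
  | |- wp _ (Seq (Const _ _) _) _ _ => apply wp_const; [try lia|]
  | |- wp _ (Seq (Copy _ _) _) _ _ => eapply wp_copy; [look|]
  | |- wp _ (Seq (Add _ _ _) _) _ _ => eapply wp_add; [look|look|try lia|]
  | |- wp _ (Seq (Sub _ _ _) _) _ _ => eapply wp_sub; [look|look|]
  | |- wp _ (Seq (Read _ _) _) _ _ => eapply wp_read; [look| |]
  | |- wp _ (Seq (Write _ _) _) _ _ => eapply wp_write; [look|look|]
  | |- wp _ (Seq (If (Less _ _) _ _) _) _ _ => eapply wp_less; [look|look| |]
  | |- wp _ (Seq (If (Equal _ _) _ _) _) _ _ => eapply wp_equal; [look|look| |]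
  end.

(** Treats the memory once for all branches of the loop body; the sums have the shape that the
    pointer increments produce. *)
Lemma table_inv_next c i s s' : i < size c -> table_inv c i s ->
  constants c s' -> reg s' 1 = i + 1 -> reg s' 2 = nth false c i ->
  let st := costs_at c i in let x := nth false c i in
  reg s' 3 = ce (step st x) -> reg s' 4 = ca (step st x) ->
  reg s' 5 = cb (step st x) -> reg s' 6 = cd (step st x) ->
  reg s' 8 = size c + 4 * i + 1 + 1 + 2 -> reg s' 19 = 0 ->
  mem s' = upd (upd (upd (upd (mem s) i (x == prev st))
    (size c + 4 * i) (source st x 0)) (size c + 4 * i + 1) (source st x 1))
    (size c + 4 * i + 1 + 1) (source st x 2) ->
  table_inv c i.+1 s'.
Proof.
move=> hi [k0 r1 r2 r3 r4 r5 r6 r8 r19 [hs hsrc] hin hz] k1 q1 q2 st x q3 q4 q5 q6 q8 q19 hm.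
split; rewrite ?costs_atS //; try lia.
- split=> [j|j k] hj; rewrite hm /upd.
    have -> : (j == size c + 4 * i + 1 + 1) = false by lia.
    have -> : (j == size c + 4 * i + 1) = false by lia.
    have -> : (j == size c + 4 * i) = false by lia.
    by case: eqP => [->|ji] //; apply: hs; lia.
  move=> hk; have [ji|ji] := ltnP j i.
    have -> : (size c + 4 * j + k == size c + 4 * i + 1 + 1) = false by lia.
    have -> : (size c + 4 * j + k == size c + 4 * i + 1) = false by lia.
    have -> : (size c + 4 * j + k == size c + 4 * i) = false by lia.
    have -> : (size c + 4 * j + k == i) = false by lia.
    exact: hsrc.
  have -> : j = i by lia.
  case: k hk => [|[|[|[|//]]]] _.
  + have -> : (size c + 4 * i + 0 == size c + 4 * i + 1 + 1) = false by lia.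
    have -> : (size c + 4 * i + 0 == size c + 4 * i + 1) = false by lia.
    by rewrite addn0 eqxx.
  + have -> : (size c + 4 * i + 1 == size c + 4 * i + 1 + 1) = false by lia.
    by rewrite eqxx.
  + have -> // : (size c + 4 * i + 2 == size c + 4 * i + 1 + 1) by lia.
  + have -> : (size c + 4 * i + 3 == size c + 4 * i + 1 + 1) = false by lia.
    have -> : (size c + 4 * i + 3 == size c + 4 * i + 1) = false by lia.
    have -> : (size c + 4 * i + 3 == size c + 4 * i) = false by lia.
    have -> : (size c + 4 * i + 3 == i) = false by lia.
    by rewrite hz.
- move=> j hj; rewrite hm /upd.
  have -> : (j == size c + 4 * i + 1 + 1) = false by lia.
  have -> : (j == size c + 4 * i + 1) = false by lia.
  have -> : (j == size c + 4 * i) = false by lia.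
  have -> : (j == i) = false by lia.
  by apply: hin; lia.
- move=> j; rewrite hm /upd.
  have -> : (size c + 4 * j + 3 == size c + 4 * i + 1 + 1) = false by lia.
  have -> : (size c + 4 * j + 3 == size c + 4 * i + 1) = false by lia.
  have -> : (size c + 4 * j + 3 == size c + 4 * i) = false by lia.
  have -> : (size c + 4 * j + 3 == i) = false by lia.
  exact: hz.
Qed.

Lemma table_step c M i s : 10 * size c <= M -> i < size c -> table_inv c i s ->
  wp M table_body (table_inv c i.+1) s.
Proof.
move=> hM hi inv.
case: (inv) => [[r0 r9 r10 r11 r12 r18] r1 r2 r3 r4 r5 r6 r8 r19 _ hin _].
have he := costs_at_le c i.
have hx : mem s i = nth false c i by apply: hin; rewrite leqnn.
rewrite /table_body; do 2!wp_step; first exact: hx.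
wp_step; rewrite nat_of_bool_eq => E1.
all: do 60 try wp_step.
all: move=> E2; do 60 try wp_step; move=> E3.
all: do 60 try wp_step.
(* Each goal is one path through the three tests; their outcomes [E1], [E2], [E3] determine [step]
   and [source]. *)
all: apply: (table_inv_next c i s) => //.
all: rewrite addn1 in E2 E3.
all: try (eapply etrans; [look|]).
all: rewrite /step /source /= ?E1 /= ?E2 ?E3 ?addn1 //.
Qed.

Lemma setup_wp c M s : c <> [::] -> 10 * size c <= M -> s = input c ->
  wp M setup (table_inv c 0) s.
Proof.
move=> c0 hM Es.
have hn : 0 < size c by case: (c) c0.
have r0 : reg s 0 = size c by rewrite Es.
have r12 : reg s 12 = 0 by rewrite Es.
have r1 : reg s 1 = 0 by rewrite Es.
have r2 : reg s 2 = 0 by rewrite Es.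
have r3 : reg s 3 = 0 by rewrite Es.
have r19 : reg s 19 = 0 by rewrite Es.
have hm : mem s = (fun i => nat_of_bool (nth false c i)) by rewrite Es.
rewrite /setup; do 20 try wp_step.
have h0 : costs_at c 0 = Costs false 0 (size c).+1 (size c).+1 (size c).+1.
  by rewrite /costs_at take0.
split; rewrite ?h0; try by [eapply etrans; [look|rewrite ?addn1 ?muln0 ?addn0]].
- by split=> //; look.
- by split.
- by move=> j _ /=; rewrite hm.
- by move=> j /=; rewrite hm nth_default //; lia.
Qed.

Lemma table_halts c M : c <> [::] -> 10 * size c <= M ->
  halts M table (input c) (table_inv c (size c)) (size c)
    (max_time setup + (size c * (max_time table_body).+1).+1).
Proof.
move=> c0 hM; rewrite -[X in halts _ _ _ _ X](add0n).
apply: (halts_seq _ _ _ _ (table_inv c 0)).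
  exact/wp_halts/setup_wp.
move=> s h.
pose I k s := k <= size c /\ table_inv c (size c - k) s.
have hI : I (size c) s by rewrite /I subnn.
have [k s1 [hk inv]|s1 [_ inv]|s' [t [e [_ q] b]]] :=
    while_halts M (Less 1 0) table_body I (size c) s _ _ hI.
- have [[r0 _ _ _ _ _] r1 _ _ _ _ _ _ _ _ _ _] := inv.
  split; first by rewrite /= r0 r1; lia.
  rewrite /I; have -> : size c - k = (size c - k.+1).+1 by lia.
  have hlt : size c - k.+1 < size c by lia.
  apply: wp_mono (table_step _ _ _ _ hM hlt inv) => s' h'; split=> //; lia.
- have [[r0 _ _ _ _ _] r1 _ _ _ _ _ _ _ _ _ _] := inv.
  by rewrite /= r0 r1 subn0 ltnn.
by exists s', t; split=> //; rewrite -[size c]subn0.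
Qed.

(* Further registers: 19 the state reached, 22 the output address, 23 and 24
   the ends of the two blocks of moves. *)
Definition retrieve : prog :=
  seqs [:: Sub 1 1 9; Sub 8 8 18; Add 20 8 19; Read 19 20].

(** * Invariants of the backward pass *)

Record back_inv (c : conformation) (i : nat) (s : state) : Prop := BackInv {
  back_const : constants c s;
  back_i : reg s 1 = i;
  back_e : reg s 3 = optimum c;
  back_ptr : reg s 8 = size c + 4 * i;
  back_target : reg s 19 = tau c i;
  back_out : reg s 22 = 5 * size c;
  back_upto : table_upto c (size c) s }.

Lemma back_inv_start c s : table_inv c (size c) s ->
  back_inv c (size c) (set_reg s 22 (5 * size c)).
Proof.
case=> [[r0 r9 r10 r11 r12 r18]] r1 _ r3 _ _ _ r8 r19 [hs hsrc] _ _.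
by split=> //; rewrite tau_size.
Qed.

Lemma wp_retrieve c M q Q i s :
  10 * size c <= M -> i < size c -> back_inv c i.+1 s ->
  (forall s', back_inv c i s' -> mem s' = mem s ->
    (forall r, r \notin [:: 1; 8; 19; 20] -> reg s' r = reg s r) ->
    wp M q Q s') ->
  wp M (Seq retrieve q) Q s.
Proof.
move=> hM hi [[r0 r9 r10 r11 r12 r18] r1 r3 r8 r19 r22 [hs hsrc]] h.
have ht := tau_le c i.+1.
rewrite /retrieve; do 3!wp_step; rewrite subn1 [i.+1.-1]/=.
do 2!wp_step; have -> : size c + 4 * i.+1 - 4 = size c + 4 * i by lia.
do 4!wp_step.
  by apply: hsrc.
rewrite -tau_source //; wp_step; apply: h => //.
move=> r; rewrite !inE => /norP [/negPf E1] /norP [/negPf E8] /norP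
  [/negPf E19] /negPf E20.
by rewrite /= /upd E1 E8 E19 E20.
Qed.

(** The input and four table cells per pawn end below [5 * size c], where the output area begins. *)
Lemma table_upto_outside c s s' : table_upto c (size c) s ->
  (forall a, a < 5 * size c -> mem s' a = mem s a) ->
  table_upto c (size c) s'.
Proof.
move=> [hs hsrc] h; split=> [j hj|j k hj hk].
  by rewrite h ?hs //; lia.
by rewrite h ?hsrc //; lia.
Qed.

Definition kept : seq nat := [:: 0; 1; 3; 8; 9; 10; 11; 12; 18; 19; 22].

Lemma back_inv_next c i s s' : back_inv c i s ->
  (forall a, a < 5 * size c -> mem s' a = mem s a) ->
  map (reg s') kept = map (reg s) kept -> back_inv c i s'.
Proof.
move=> [[? ? ? ? ? ?] ? ? ? ? ? hu] hm [? ? ? ? ? ? ? ? ? ? ?].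
by split; [split| | | | | |exact: table_upto_outside hu hm]; congruence.
Qed.

Definition block (m : nat -> nat) (a : nat) (l : seq nat) : Prop :=
  forall k, k < size l -> m (a + k) = nth 0 l k.

Lemma output_block s l : reg s 1 = size l -> block (mem s) (reg s 0) l ->
  output s = l.
Proof.
move=> hl h; rewrite /output hl; apply: (@eq_from_nth _ 0).
  by rewrite size_map size_iota.
move=> k; rewrite size_map size_iota => hk.
by rewrite (nth_map 0) ?size_iota // nth_iota // add0n h.
Qed.

Lemma block_cat m a l1 l2 :
  block m a l1 -> block m (a + size l1) l2 -> block m a (l1 ++ l2).
Proof.
move=> h1 h2 k; rewrite size_cat nth_cat => hk.
case: ltnP => [|ge]; first exact: h1.
rewrite -h2; last lia.
by congr m; lia.
Qed.

Lemma block_cons m a x l : m a = x -> block m (a + 1) l -> block m a (x :: l).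
Proof. by move=> h; apply: (block_cat m a [:: x]) => -[|//] _; rewrite addn0. Qed.

Lemma block_upd m a l x v : block m a l -> (x < a) || (a + size l <= x) ->
  block (upd m x v) a l.
Proof.
by move=> h hx k hk; rewrite /upd; case: eqP => [E|_]; [lia|exact: h].
Qed.

Definition word_body : prog :=
  Seq retrieve
    (seqs [:: Read 21 1;
      If (Equal 19 12) Skip (If (Equal 19 10) (Add 21 21 18) (Add 21 21 10));
      Add 20 22 1; Write 20 21]).

Record word_inv (c : conformation) (i : nat) (s : state) : Prop := WordInv {
  word_back : back_inv c i s;
  word_cells : forall j, i <= j < size c ->
    mem s (5 * size c + j) = same_at c j + crossing_code (tau c j) }.

Lemma word_step c M i s : 10 * size c <= M -> i < size c ->
  word_inv c i.+1 s -> wp M word_body (word_inv c i) s.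
Proof.
move=> hM hi [hb hw]; apply: (wp_retrieve _ _ _ _ _ _ hM hi hb) => {hb} s' hb hm _.
have [[r0 r9 r10 r11 r12 r18] r1 r3 r8 r19 r22 hu] := hb.
have [hs _] := hu.
have hb1 : same_at c i <= 1 by case: same_at.
have H v s1 : v = same_at c i + crossing_code (tau c i) ->
    map (reg s1) kept = map (reg s') kept -> mem s1 = mem s' ->
    word_inv c i (set_mem s1 (5 * size c + i) v).
  move=> -> hreg E; split.
    apply: (back_inv_next _ _ _ _ hb) => // a ha.
    by rewrite -E /= /upd; case: eqP => // ?; lia.
  move=> j hj; rewrite /= /upd eqn_add2l; case: eqP => [->//|/eqP ji].
  rewrite E hm hw //; lia.
do 2!wp_step; first exact: hs.
wp_step => E0; do 10 try wp_step.
- by apply: H => //; rewrite (eqP E0) /= addn0.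
- move=> E2; do 10 try wp_step.
  by apply: H => //; rewrite (eqP E2).
- move=> E2; do 10 try wp_step; apply: H => //.
  by move: E0 E2; case: (tau c i) => [|[|[|?]]].
Qed.

(** Separations are met from right to left, which is the playing order of the left moves and the
    reverse of that of the right moves. A right move is therefore written downwards, its target
    first. *)
Definition moves_body : prog :=
  Seq retrieve
    (seqs [:: If (Equal 19 12) Skip
      (Seq (Sub 20 1 9)
        (If (Equal 19 10)
          (seqs [:: Write 23 1; Add 23 23 9; Write 23 20; Add 23 23 9])
          (seqs [:: Sub 24 24 9; Write 24 1; Sub 24 24 9; Write 24 20])))]).

Definition pending (c : conformation) (i : nat) : nat :=
  count (fun j => tau c j != 0) (iota 0 i).

(** The gap between the two blocks is exactly what the pending moves need, so the blocks meet at
    [i = 0]. *)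
Record moves_inv (c : conformation) (i : nat) (s : state) : Prop := MovesInv {
  moves_back : back_inv c i s;
  moves_value : mem s (5 * size c) = optimum c;
  moves_left : reg s 23 = 5 * size c + 1 + size (moves_code (lefts c i));
  moves_right : reg s 24 = reg s 23 + 2 * pending c i;
  moves_lefts : block (mem s) (5 * size c + 1) (moves_code (lefts c i));
  moves_rights : block (mem s) (reg s 24) (moves_code (rights c i)) }.

Lemma moves_code_cat g1 g2 : moves_code (g1 ++ g2) = moves_code g1 ++ moves_code g2.
Proof. by rewrite /moves_code map_cat flatten_cat. Qed.

Lemma size_moves_code g : size (moves_code g) = 2 * size g.
Proof. by elim: g => //= m g IH; rewrite IH mulnS. Qed.

Lemma pendingS c i : pending c i.+1 = pending c i + (tau c i != 0).
Proof. by rewrite /pending -addn1 iotaD count_cat /= addn0. Qed.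

Lemma pending_size c : optimum c + pending c (size c) = size c.
Proof. by rewrite optimum_count /pending count_predC size_iota. Qed.

Lemma size_lefts c i : size (lefts c i) <= size c - i.
Proof.
by rewrite size_map size_filter (leq_trans (count_size _ _)) // size_rev size_iota.
Qed.

Lemma pending_le c i : pending c i <= i.
Proof. by rewrite -[X in _ <= X](size_iota 0); exact: count_size. Qed.

Lemma moves_step c M i s : 10 * size c <= M -> i < size c ->
  moves_inv c i.+1 s -> wp M moves_body (moves_inv c i) s.
Proof.
move=> hM hi [hb hv hl hr bl br].
apply: (wp_retrieve _ _ _ _ _ _ hM hi hb) => {hb} s' hb hm hreg.
have [[r0 r9 r10 r11 r12 r18] r1 r3 r8 r19 r22 hu] := hb.
have hp : pending c i <= i := pending_le c i.
have hsl := size_lefts c i.+1.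
have hL := leftsS c i hi; have hR := rightsS c i hi; have hP := pendingS c i.
rewrite -hm in hv bl br; rewrite -!hreg // in hl hr br.
rewrite size_moves_code in hl.
have hbn s1 : map (reg s1) kept = map (reg s') kept ->
    (forall a, a < 5 * size c -> mem s1 a = mem s' a) -> back_inv c i s1.
  by move=> h1 h2; exact: back_inv_next hb h2 h1.
wp_step; wp_step => E0; do 10 try wp_step.
  move: hR hL hP; rewrite (eqP E0) /= cats0 addn0 => hR hL hP.
  by split; rewrite ?hR ?hL -?hP ?size_moves_code.
(* The separation is crossed, so one pending move reserves the two cells about to be written, clear
   of both blocks. *)
all: rewrite E0 addn1 in hP.
all: set l := size (lefts c i.+1) in hl hsl *; set r := pending c i in hp hP *.
all: move=> E2; do 10 try wp_step; rewrite ?hP ?hl.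
  rewrite E2 in hL; rewrite (eqP E2) /= in hR.
  split.
  - apply: hbn => // a ha; rewrite /= /upd.
    by do 2!(case: eqP => [?|_]; first lia).
  - by rewrite /= /upd; do 2!(case: eqP => [?|_]; first lia).
  - by eapply etrans; [look|rewrite hL size_moves_code size_cat /= -/l; lia].
  - rewrite reg_set; eapply etrans; [look|rewrite -/r; lia].
  - rewrite hL moves_code_cat; apply: block_cat.
      by do 2!(apply: block_upd; last by rewrite size_moves_code -/l; lia).
    rewrite size_moves_code -/l; apply: block_cons.
      by rewrite /= /upd; case: eqP => [?|_]; [lia|rewrite eqxx].
    by apply: block_cons; rewrite //= /upd eqxx subn1.
  - set a := reg _ 24; have -> : a = reg s' 24 by [].
    rewrite hR; do 2!(apply: block_upd; last by rewrite hr hP hl; lia).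
    exact: br.
have hG : goes_right (tau c i).
  by move: (tau_le c i) E0 E2; rewrite /goes_right; case: (tau c i) => [|[|[|[|?]]]].
rewrite E2 cats0 in hL; rewrite hG in hR.
split.
- apply: hbn => // a ha; rewrite /= /upd.
  by do 2!(case: eqP => [?|_]; first lia).
- by rewrite /= /upd; do 2!(case: eqP => [?|_]; first lia).
- by eapply etrans; [look|rewrite hL size_moves_code].
- set a := reg _ 23; have -> : a = reg s' 23 by [].
  eapply etrans; [look|rewrite -/r hl; lia].
- by rewrite hL; do 2!(apply: block_upd; last by rewrite size_moves_code -/l; lia).
- set a := reg _ 24.
  have -> : a = 5 * size c + 1 + 2 * l + 2 * r.+1 - 1 - 1 by [].
  rewrite hR; apply: block_cons; first by rewrite /= /upd eqxx subn1.
  apply: block_cons.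
    by rewrite /= /upd; case: eqP => [?|_]; [lia|case: eqP => [//|?]; lia].
  rewrite (_ : _ + 1 + 1 = reg s' 24); last by rewrite hr hP hl; lia.
  by do 2!(apply: block_upd; last by rewrite hr hP hl; lia).
Qed.

Lemma back_loop_halts c M (I : nat -> state -> Prop) body s :
  (forall i s, I i s -> back_inv c i s) ->
  (forall i s, i < size c -> I i.+1 s -> wp M body (I i) s) ->
  I (size c) s ->
  halts M (While (Less 12 1) body) s (I 0) 0
    (size c * (max_time body).+1).+1.
Proof.
move=> hI hS hs.
pose J k s := k <= size c /\ I k s.
have [k s1 [hk h]|s1 [_ h]||s' [t [e [_ q] b]]] :=
    while_halts M (Less 12 1) body J (size c) s.
- have [[_ _ _ _ r12 _] r1 _ _ _ _ _] := hI _ _ h.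
  split; first by rewrite /= r12 r1.
  by apply: wp_mono (hS _ _ hk h) => s' h'; split=> //; exact: ltnW.
- by have [[_ _ _ _ r12 _] r1 _ _ _ _ _] := hI _ _ h; rewrite /= r12 r1.
- by split.
by exists s', t; split=> //; case/andP: b => _ ->.
Qed.

(** * The complete programs and their running times *)

Definition word_prog : prog :=
  Seq table (Seq (Copy 22 8) (Seq (While (Less 12 1) word_body)
    (seqs [:: Sub 1 0 9; Add 0 22 9]))).

(** After the first pass the optimum, hence the number of moves, is known; this fixes the end of the
    output in register 24 before any move is found. *)
Definition moves_prog : prog :=
  Seq table (Seq
    (seqs [:: Copy 22 8; Write 22 3; Add 23 22 9; Sub 20 0 3; Add 24 23 20;
              Add 24 24 20])
    (Seq (While (Less 12 1) moves_body)
      (seqs [:: Sub 1 0 3; Add 1 1 1; Add 1 1 9; Copy 0 22]))).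

Lemma word_prog_halts c M : c <> [::] -> 10 * size c <= M ->
  exists hi, hi <= (max_time setup + max_time table_body + max_time word_body + 10)
                    * size c /\
  halts M word_prog (input c)
    (fun s => output s = word_code (word_of c (solution c))) (size c) hi.
Proof.
move=> c0 hM; have hn : 0 < size c by case: (c) c0.
(* Unification fills in the time bound; its constant terms are absorbed because [size c] is
   positive. *)
eexists; split; last first.
  rewrite -[X in halts _ _ _ _ X]addn0.
  apply: (halts_seq _ _ _ _ _ _ _ _ _ _ (table_halts c M c0 hM)) => s1 h1.
  rewrite -[X in halts _ _ _ _ X]addn0.
  apply: (halts_seq _ _ _ _ (word_inv c (size c))).
    apply: wp_halts => /=.
    have [_ _ _ _ _ _ _ r8 _ _ _ _] := h1; rewrite r8.
    split; last by move=> j; lia.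
    rewrite (_ : _ + _ = 5 * size c); last lia.
    exact: back_inv_start.
  move=> s2 h2; rewrite -[X in halts _ _ _ _ X]addn0.
  apply: (halts_seq _ _ _ _ (word_inv c 0)).
    apply: (back_loop_halts c) => //; first by move=> i s [].
    by move=> i s; exact: word_step.
  move=> s3 [[[r0 r9 r10 r11 r12 r18] r1 r3 r8 r19 r22 hu] hw].
  apply: wp_halts; do 10 try wp_step.
  have hs : size (word_code (word_of c (solution c))) = (size c).-1.
    by rewrite size_map size_word_of.
  apply: output_block; rewrite ?hs.
    by eapply etrans; [look|rewrite subn1].
  rewrite reg_set => k; rewrite hs => hk.
  rewrite (nth_map a_bar) ?size_word_of //.
  rewrite (nth_map 0) ?size_iota // nth_iota // add0n.
  (* Separation [k] is governed by [tau c k.+1], so its letter is in cell [5 * size c + 1 + k]; this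
     is why the output starts one cell into the area. *)
  rewrite crossing_letter_solution // /= -addnA hw ?add1n; last lia.
  by rewrite /same_at prev_costs_at 1?eq_sym //; lia.
rewrite /=; lia.
Qed.

Lemma moves_prog_halts c M : c <> [::] -> 10 * size c <= M ->
  exists hi, hi <= (max_time setup + max_time table_body + max_time moves_body + 20)
                    * size c /\
  halts M moves_prog (input c)
    (fun s => output s = optimum c :: moves_code (solution c)) 0 hi.
Proof.
move=> c0 hM; have hn : 0 < size c by case: (c) c0.
have hp := pending_size c.
have hl : lefts c (size c) = [::] by rewrite /lefts subnn.
have hr : rights c (size c) = [::] by rewrite /rights subnn.
eexists; split; last first.
  have [s1 [t1 [e1 h1 b1]]] := table_halts c M c0 hM.
  rewrite -[X in halts _ _ _ _ X]addn0.
  apply: (halts_seq _ _ _ _ (table_inv c (size c))).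
    by exists s1, t1; split=> //; case/andP: b1 => _ b1; exact: b1.
  move=> {e1 h1 b1 t1}s1 h1; rewrite -[X in halts _ _ _ _ X]addn0.
  apply: (halts_seq _ _ _ _ (moves_inv c (size c))).
    apply: wp_halts.
    have [[r0 r9 r10 r11 r12 r18] r1 _ r3 _ _ _ r8 r19 hu _ _] := h1.
    have hb0 := back_inv_start c s1 h1.
    rewrite -/(optimum c) in r3.
    have {}r8 : reg s1 8 = 5 * size c by rewrite r8; lia.
    do 20 try wp_step.
    split.
    - apply: (back_inv_next _ _ _ _ hb0) => // a ha.
      by rewrite /= /upd; case: eqP => // ?; lia.
    - by rewrite /= /upd eqxx.
    - by eapply etrans; [look|rewrite hl addn0].
    - set a := reg _ 23; have -> : a = 5 * size c + 1 by [].
      by eapply etrans; [look|lia].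
    - by rewrite hl.
    - by rewrite hr.
  move=> s2 h2; rewrite -[X in halts _ _ _ _ X]addn0.
  apply: (halts_seq _ _ _ _ (moves_inv c 0)).
    apply: (back_loop_halts c) => //; first by move=> i s [].
    by move=> i s; exact: moves_step.
  move=> s3 [[[r0 r9 r10 r11 r12 r18] r1 r3 r8 r19 r22 hu] hv h23 h24 bl br].
  apply: wp_halts.
  have hs := size_solution c.
  do 20 try wp_step.
  apply: output_block.
    eapply etrans; [look|].
    by rewrite /= size_moves_code; lia.
  rewrite reg_set; apply: block_cons => //.
  rewrite moves_code_cat; apply: block_cat => //.
  by rewrite h24 h23 muln0 addn0 in br.
rewrite /=; lia.
Qed.

Theorem theorem11 :
  (exists (p : prog) (m k1 k2 : nat),
    forall c : conformation, c <> [::] ->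
      exists (w : seq letter) (t : nat),
        [/\ runs p m c (word_code w) t,
            optimal c w,
            size c <= k1 * t
          & t <= k2 * size c])
  /\
  (exists (p : prog) (m k : nat),
    forall c : conformation, c <> [::] ->
      exists (v : nat) (g : seq clobber_move) (t : nat),
        [/\ runs p m c (v :: moves_code g) t,
            is_reducibility_value c v,
            game c g /\ remaining c g = v
          & t <= k * size c]).
Proof.
split.
  (* Input and table take [5 * size c] cells and either output at most [2 * size c + 1] more, within
     capacity [10 * size c]. The constant 1 comes from one iteration of the first pass per pawn. *)
  exists word_prog, 10, 1; eexists=> c c0.
  have [hi [hhi [s [t [e h /andP [ht1 ht2]]]]]] :=
    word_prog_halts c (10 * size c) c0 (leqnn _).
  exists (word_of c (solution c)), t; split.
  - by exists s.
  - exact: solution_optimal.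
  - by rewrite mul1n.
  - exact: leq_trans ht2 hhi.
exists moves_prog, 10; eexists=> c c0.
have [hi [hhi [s [t [e h /andP [_ ht]]]]]] :=
  moves_prog_halts c (10 * size c) c0 (leqnn _).
exists (optimum c), (solution c), t; split.
- by exists s.
- exact: optimum_is_reducibility_value.
- by split; [exact: (proj1 (solution_game c))|exact: remaining_solution].
- exact: leq_trans ht hhi.
Qed.
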